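(* Let $d>1$ and let $F:\mathbb{R}^d\to\mathbb{R}^d$ be locally Lipschitz such that the flow $\phi^t$ of $\dot u=F(u)$ is defined for all $t\ge 0$. (i) If $F$ is chaotic on the whole domain $\mathbb{R}^d$, then $F$ is discoverable from a single trajectory in the space $C^0(\mathbb{R}^d,\mathbb{R}^d)$ of continuous functions. (ii) If $F$ is discoverable from a single trajectory in $C^0(\mathbb{R}^d,\mathbb{R}^d)$, then $F$ is topologically transitive.
   Context: For $x\in\mathbb{R}^d$ put $\operatorname{Traj}(x,F)=\{\phi^t(x): t\ge 0\}$. Discoverability: let $V$ be a set of functions $\mathbb{R}^d\to\mathbb{R}^d$ with $F\in V$. $F$ is discoverable from a single trajectory in $V$ if there exist an open interval $U\subseteq\mathbb{R}$ and a differentiable $u:U\to\mathbb{R}^d$ with $\dot u=F(u)$ on $U$, such that $F$ is the only element $G$ of $V$ satisfying $\dot u=G(u)$ on $U$. Topological transitivity: for all non-empty open $W_1,W_2\subseteq\mathbb{R}^d$ there is $t>0$ with $\phi^t(W_1)\cap W_2\neq\emptyset$. Chaos: $F$ is chaotic on an invariant set $A$ (i.e. $\phi^t(A)\subseteq A$ for $t\ge0$) if (a) the flow restricted to $A$ has sensitive dependence on initial conditions: for each $x\in A$ there is $r>0$ such that for all $\delta>0$ there are $y\in A$ and $t\ge 0$ with $\|y-x\|\le\delta$ and $\|\phi^t(y)-\phi^t(x)\|>r$; and (b) there is $x^*\in A$ with $\overline{\operatorname{Traj}(x^*,F)}=A$. Chaotic on the whole domain means chaotic on $A=\mathbb{R}^d$.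 *)

(* Defs.v *)
From HB Require Import structures.
From mathcomp Require Import all_boot all_order all_algebra.
From mathcomp Require Import all_classical all_reals all_analysis.

Set Implicit Arguments.
Unset Strict Implicit.
Unset Printing Implicit Defensive.

Import Order.TTheory GRing.Theory Num.Theory.
Import numFieldNormedType.Exports.

Local Open Scope classical_set_scope.
Local Open Scope ring_scope.

(* R^d is 'rV[R]_d with the library's sup norm. The norm enters only through
   local Lipschitz continuity and sensitive dependence, and neither property
   changes when the norm is replaced by an equivalent one, for instance the
   Euclidean norm. *)

Definition locally_lipschitz (R : realType) (d : nat)
    (F : 'rV[R]_d -> 'rV[R]_d) : Prop :=
  forall x : 'rV[R]_d, exists2 A : set 'rV[R]_d, nbhs x A & [lipschitz F y | y in A].

(* Meant for open U: [u] is total, but only its values on U matter. *)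
Definition solution_on (R : realType) (d : nat) (F : 'rV[R]_d -> 'rV[R]_d)
    (U : set R) (u : R -> 'rV[R]_d) : Prop :=
  forall t, U t -> is_derive t (1 : R) u (F (u t)).

(* [phi t x] is the value at time t of the solution starting at x; it is
   meaningful for t >= 0 only, so the derivative at 0 is one-sided. For locally
   Lipschitz F this determines [phi t] uniquely for all t >= 0. *)
Definition is_flow (R : realType) (d : nat) (F : 'rV[R]_d -> 'rV[R]_d)
    (phi : R -> 'rV[R]_d -> 'rV[R]_d) : Prop :=
  forall x : 'rV[R]_d, [/\ phi 0 x = x,
    h^-1 *: (phi h x - phi 0 x) @[h --> (0 : R)^'+] --> F (phi 0 x) &
    solution_on F [set t | 0 < t] (phi ^~ x)].

Definition traj (R : realType) (d : nat) (phi : R -> 'rV[R]_d -> 'rV[R]_d)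
    (x : 'rV[R]_d) : set 'rV[R]_d :=
  [set phi t x | t in [set t | 0 <= t]].

(* The set equality says both that F lies in V and solves the equation, and
   that no other element of V does. *)
Definition discoverable (R : realType) (d : nat)
    (V : set ('rV[R]_d -> 'rV[R]_d)) (F : 'rV[R]_d -> 'rV[R]_d) : Prop :=
  exists (U : set R) (u : R -> 'rV[R]_d),
    [/\ open U, is_interval U, U !=set0 &
        [set G | V G /\ solution_on G U u] = [set F]].

Definition topologically_transitive (R : realType) (d : nat)
    (phi : R -> 'rV[R]_d -> 'rV[R]_d) : Prop :=
  forall W1 W2 : set 'rV[R]_d,
    open W1 -> W1 !=set0 -> open W2 -> W2 !=set0 ->
    exists2 t : R, 0 < t & (phi t @` W1) `&` W2 !=set0.

Definition forward_invariant (R : realType) (d : nat)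
    (phi : R -> 'rV[R]_d -> 'rV[R]_d) (A : set 'rV[R]_d) : Prop :=
  forall t : R, 0 <= t -> phi t @` A `<=` A.

Definition sensitive_dependence (R : realType) (d : nat)
    (phi : R -> 'rV[R]_d -> 'rV[R]_d) (A : set 'rV[R]_d) : Prop :=
  forall x : 'rV[R]_d, A x -> exists2 r : R, 0 < r &
    forall delta : R, 0 < delta ->
      exists (y : 'rV[R]_d) (t : R),
        [/\ A y, 0 <= t, `|y - x| <= delta & r < `|phi t y - phi t x|].

Definition chaotic (R : realType) (d : nat)
    (phi : R -> 'rV[R]_d -> 'rV[R]_d) (A : set 'rV[R]_d) : Prop :=
  [/\ forward_invariant phi A, sensitive_dependence phi A &
      exists2 x, A x & closure (traj phi x) = A].

Definition C0 (R : realType) (d : nat) : set ('rV[R]_d -> 'rV[R]_d) :=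
  [set G | continuous G].

(* Main.v *)
Require Import Defs.
From HB Require Import structures.
From mathcomp Require Import all_boot all_order all_algebra.
From mathcomp Require Import all_classical all_reals all_analysis.
From mathcomp Require Import ring lra.

Set Implicit Arguments.
Unset Strict Implicit.
Unset Printing Implicit Defensive.

Import Order.TTheory GRing.Theory Num.Theory.
Import numFieldNormedType.Exports.

Local Open Scope classical_set_scope.
Local Open Scope ring_scope.

(** Both parts rest on the density of a trajectory.

    (i) A chaotic field has a dense forward orbit. The orbit is itself a solution
    on the positive times, and a continuous field solved by it is prescribed on
    the orbit, hence everywhere ([forward_dense_determines]).

    (ii) Conversely, the solution [u] that determines [F] among continuous fields
    must be dense, since otherwise [F] could be changed by a bump away from it
    ([discoverable_dense]). If [u] visits [W1] before [W2], the semiflow carries a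
    point of [W1] into [W2], because a solution of a locally Lipschitz equation
    follows the semiflow ([flow_unique]). The order of the visits may however be
    the wrong one: [u] may be defined for negative times, on a bounded or
    unbounded interval, and be dense only because of its past. The remedy is a
    recurrence argument. Let [u s2] be in [W2] and [u s1] in [W1] with
    [m = s1 - s2 >= 0]. By continuous dependence on the initial point
    ([arc_stability]), every passage of [u] close to [u s2] is followed by a
    passage through [W1] after time [m]. It remains to find two passages
    close to [u s2] that are more than [m] apart, the later of which visits [W2]
    after the earlier one has led to [W1].

    Such passages exist because the dimension is at least 2
    ([dense_solution_returns_late]): the speed of [u] is bounded near [u s2], and
    a curve of bounded speed needs a time of order [n] to come near [n ^ 2]
    points with mutual distances of order [1 / n]. This count is
    insensitive to the interval of definition of [u] and to the behaviour of [u]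
    at its ends. *)

(** * Sup norm and coordinates *)

Lemma rV_coord_le_norm (R : realType) (d : nat) (x : 'rV[R]_d) (i : 'I_d) :
  `|x ord0 i| <= `|x|.
Proof.
rewrite [leRHS]/Num.Def.normr/= mx_normrE.
exact: (le_bigmax _ (fun ij : 'I_1 * 'I_d => `|x ij.1 ij.2|) (ord0, i)).
Qed.

Lemma rV_norm_le (R : realType) (d : nat) (x : 'rV[R]_d) (e : R) :
  0 <= e -> (forall i, `|x ord0 i| <= e) -> `|x| <= e.
Proof.
move=> e0 xe; rewrite [leLHS]/Num.Def.normr/= mx_normrE.
by apply: bigmax_le => // -[i j] _ /=; rewrite (ord1 i).
Qed.

(** * First exit times *)

(** A continuous function cannot reach the level [c] at a first time: at the
    infimum of the times where [c <= f], the hypothesis gives [f < c], and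
    continuity then keeps [f] below [c] slightly later. This turns an estimate
    that is valid as long as a curve stays in some region into a proof that the
    curve does stay there. *)
Lemma before_exit (R : realType) (f : R -> R) (a b c : R) :
  {within `[a, b], continuous f} ->
  (forall t, a <= t <= b -> (forall s, a <= s < t -> f s < c) -> f t < c) ->
  forall t, a <= t <= b -> f t < c.
Proof.
move=> cf step t tab; rewrite ltNge; apply/negP => cft.
pose S := [set s | a <= s <= b /\ c <= f s].
have St : S t by [].
have hS : has_inf S by split; [exists t | exists a => s [/andP[]]].
set s0 := inf S.
have as0 : a <= s0 by apply: lb_le_inf; [exists t | move=> s [/andP[]]].
have s0b : s0 <= b.
  by apply: le_trans (ge_inf hS.2 St) _; case/andP: tab.
have s0ab : a <= s0 <= b by rewrite as0.
have fs0 : f s0 < c.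
  apply: step => // s /andP[as_ ss0]; rewrite ltNge; apply/negP => cfs.
  have : s0 <= s.
    apply: (ge_inf hS.2); split=> //.
    by rewrite as_ (le_trans (ltW ss0)).
  by rewrite leNgt ss0.
have nb : \forall s \near within `[a, b] (nbhs s0), f s < c.
  rewrite (@nbhs_subspace_in _ `[a, b]%classic s0); last by rewrite /= in_itv.
  apply: (cf s0 [set y | y < c]); exact: lt_nbhsl.
move: nb => /nbhs_ballP[e /= e0 be].
have [s [sab cfs] ss0] := inf_adherent e0 hS.
have s0s : s0 <= s by apply: (ge_inf hS.2).
have : f s < c.
  apply: be; last by rewrite /= in_itv.
  by rewrite /ball /= ltr_norml; apply/andP; split; lra.
by rewrite ltNge cfs.
Qed.

(** * Arcs of solutions and their speed *)

(** The equation is required only inside the interval, and mere continuity at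
    the end points, because a semiflow is only one-sidedly differentiable at
    time 0. *)
Definition arc (R : realType) (d : nat) (F : 'rV[R]_d -> 'rV[R]_d)
    (u : R -> 'rV[R]_d) (a b : R) : Prop :=
  {within `[a, b], continuous u} /\
  solution_on F [set t | a < t < b] u.

Lemma arc_sub (R : realType) (d : nat) (F : 'rV[R]_d -> 'rV[R]_d)
    (u : R -> 'rV[R]_d) (a b a' b' : R) :
  a <= a' -> b' <= b -> arc F u a b -> arc F u a' b'.
Proof.
move=> aa bb [cu du]; split; last first.
  move=> t /= /andP[at_ tb]; apply: du => /=.
  by rewrite (le_lt_trans aa)//= (lt_le_trans tb).
apply: continuous_subspaceW cu; apply: subset_itv; by rewrite bnd_simp.
Qed.

Lemma is_derive_coord (R : realType) (d : nat) (u : R -> 'rV[R]_d)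
    (t : R) (v : 'rV[R]_d) (i : 'I_d) :
  is_derive t (1 : R) u v ->
  is_derive t (1 : R) (fun s => u s ord0 i) (v ord0 i).
Proof.
move=> [du Du]; have ci := (derivable_mxP u t 1).1 du.
by split => //; rewrite -Du derive_mx// mxE.
Qed.

Lemma within_continuous_coord (R : realType) (d : nat) (A : set R)
    (u : R -> 'rV[R]_d) (i : 'I_d) :
  {within A, continuous u} -> {within A, continuous (fun s => u s ord0 i)}.
Proof.
move=> cu t.
exact: (continuous_comp (cu t) (@coord_continuous R 1 d ord0 i (u t))).
Qed.

(** The mean value theorem holds for each coordinate separately, and the sup
    norm reassembles the coordinates without loss. *)
Lemma arc_displacement (R : realType) (d : nat) (F : 'rV[R]_d -> 'rV[R]_d)
    (u : R -> 'rV[R]_d) (a b M : R) :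
  a <= b -> arc F u a b -> (forall t, a < t < b -> `|F (u t)| <= M) ->
  `|u b - u a| <= M * (b - a).
Proof.
rewrite le_eqVlt => /predU1P[<-|ab] [cu du] FM.
  by rewrite !subrr normr0 mulr0.
have M0 : 0 <= M.
  by apply: le_trans (FM ((a + b) / 2) _) => //; apply/andP; split; lra.
apply: rV_norm_le => [|i]; first by rewrite mulr_ge0// subr_ge0 ltW.
rewrite !mxE.
have [||c cab ->] := @MVT R (fun s => u s ord0 i) (fun s => F (u s) ord0 i) a b ab.
- by move=> x; rewrite in_itv /= => xab; apply: is_derive_coord; apply: du.
- exact: within_continuous_coord.
have ba0 : 0 <= b - a by rewrite subr_ge0 ltW.
rewrite normrM [`|b - a|]ger0_norm// ler_wpM2r//.
by apply: le_trans (rV_coord_le_norm _ _) _; apply: FM; rewrite in_itv/= in cab.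
Qed.

(** The speed bound [M] is only known near [p]. As long as the arc has moved by
    less than [sigma <= rho] it remains within [2 * rho] of [p], so its
    displacement is at most [M * (b - a) < sigma]; hence it never gets to move
    by [sigma]. *)
Lemma slow_arc (R : realType) (d : nat) (F : 'rV[R]_d -> 'rV[R]_d)
    (u : R -> 'rV[R]_d) (a b : R) (p : 'rV[R]_d) (rho M sigma : R) :
  a <= b -> arc F u a b ->
  (forall y, `|y - p| < 2 * rho -> `|F y| <= M) -> 0 < M ->
  `|u a - p| < rho -> sigma <= rho ->
  M * (b - a) < sigma -> `|u b - u a| < sigma.
Proof.
move=> ab au FM M0 ua sr Mab.
apply: (@before_exit R (fun t => `|u t - u a|) a b sigma) => [||]; last first.
- by rewrite ab lexx.
- move=> t /andP[at_ tb] Ht.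
  apply: le_lt_trans (_ : M * (t - a) < sigma).
    apply: (arc_displacement at_ (arc_sub (lexx a) tb au)).
    move=> s /andP[as_ st]; apply: FM.
    rewrite -(subrKA (u a)); apply: le_lt_trans (ler_normD _ _) _.
    have := Ht s; rewrite (ltW as_) st => /(_ isT) ?; lra.
  apply: le_lt_trans Mab; rewrite ler_wpM2l ?(ltW M0)//; lra.
- move=> t; apply: continuous_comp; last exact: norm_continuous.
  apply: continuousB; [exact: au.1 | exact: cst_continuous].
Qed.

(** * Local Lipschitz continuity *)

Lemma locally_lipschitz_continuous (R : realType) (d : nat)
    (F : 'rV[R]_d -> 'rV[R]_d) : locally_lipschitz F -> continuous F.
Proof.
move=> lipF x; have [A Ax] := lipF x.
move=> /pinfty_ex_gt0[M M0 FM].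
move=> B /nbhs_ballP[e /= e0 eB].
have /nbhs_ballP[r /= r0 rA] := Ax.
apply/nbhs_ballP; exists (Num.min r (e / M)) => /=.
  by rewrite lt_min r0 divr_gt0.
move=> y; rewrite -ball_normE /= lt_min => /andP[xyr yx].
have Ay : A y by apply: rA; rewrite -ball_normE.
apply: eB; rewrite -ball_normE /=.
apply: le_lt_trans (FM (x, y) _) _ => /=.
  by split => //; exact: nbhs_singleton.
by rewrite mulrC -ltr_pdivlMr.
Qed.

(** One parameter [N] serves both for the Lipschitz bound and, as [N^-1], for the
    width of the neighbourhood: the property then gets weaker as [N] grows, holds
    near each point of [K] for large [N], and compactness makes [N] uniform. *)
Lemma lipschitz_near_compact (R : realType) (d : nat)
    (F : 'rV[R]_d -> 'rV[R]_d) (K : set 'rV[R]_d) :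
  locally_lipschitz F -> compact K ->
  exists2 N : R, 0 < N & forall x y, K x -> `|y - x| < N^-1 ->
    `|F y - F x| <= N * `|y - x|.
Proof.
move=> lipF /compact_near_coveringP cK.
pose P (N : R) (x : 'rV[R]_d) :=
  forall y, `|y - x| < N^-1 -> `|F y - F x| <= N * `|y - x|.
have : \forall N \near +oo, K `<=` P N.
  apply: cK => x Kx; have [A Ax] := lipF x.
  move=> /pinfty_ex_gt0[M M0 FM].
  have /nbhs_ballP[e /= e0 eA] := Ax.
  have e20 : 0 < e / 2 by rewrite divr_gt0.
  exists (ball x (e / 2), [set N | Num.max M (e / 2)^-1 < N]) => /=.
    by split; [exact: nbhsx_ballx | apply: nbhs_pinfty_gt; rewrite num_real].
  move=> [x' N] /= [xx']; rewrite gt_max => /andP[MN eN] y yx'.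
  have Ne : N^-1 < e / 2.
    by rewrite invf_plt// ?posrE// (lt_trans _ eN)// invr_gt0.
  have Ax' : A x' by apply: eA; apply: le_ball xx'; lra.
  have Ay : A y.
    apply: eA; rewrite (splitr e); apply: ball_triangle xx' _.
    by rewrite -ball_normE /ball_ /= distrC (lt_trans yx').
  apply: le_trans (FM (y, x') _) _ => //=.
  by rewrite ler_wpM2r// ltW.
move=> KP; near (pinfty_nbhs R) => N; exists N.
  by near: N; exact: nbhs_pinfty_gt.
by move=> x y Kx; apply: (near KP N).
Unshelve. all: by end_near. Qed.

(** * Continuous dependence on the initial point *)

(** The squared Euclidean norm: unlike the sup norm, it is differentiable along
    a difference of two solutions. *)
Definition sqnorm (R : realType) (d : nat) (x : 'rV[R]_d) : R :=
  \sum_(i < d) x ord0 i ^+ 2.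

Lemma sqr_norm_le_sqnorm (R : realType) (d : nat) (x : 'rV[R]_d) :
  `|x| ^+ 2 <= sqnorm x.
Proof.
have s0 : 0 <= sqnorm x by apply: sumr_ge0 => i _; rewrite sqr_ge0.
rewrite -[leRHS]sqr_sqrtr// lerXn2r ?nnegrE ?sqrtr_ge0//.
apply: rV_norm_le => [|i]; first exact: sqrtr_ge0.
rewrite -sqrtr_sqr ler_wsqrtr// /sqnorm (bigD1 i)//= lerDl.
by apply: sumr_ge0 => j _; rewrite sqr_ge0.
Qed.

Lemma sqnorm_le_sqr_norm (R : realType) (d : nat) (x : 'rV[R]_d) :
  sqnorm x <= d%:R * `|x| ^+ 2.
Proof.
apply: le_trans (_ : \sum_(i < d) `|x| ^+ 2 <= _).
  apply: ler_sum => i _; rewrite -normr_id -[leLHS]real_normK ?num_real//.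
  by rewrite lerXn2r ?nnegrE// normr_id rV_coord_le_norm.
by rewrite sumr_const card_ord mulr_natl.
Qed.

(** Gronwall's inequality: [E t = sqnorm (w t - v t)] satisfies [E' <= k * E] with
    [k = 2 * L * d], so [E t * expR (- k * (t - a))] is nonincreasing. *)
Lemma sqnorm_gronwall (R : realType) (d : nat) (F : 'rV[R]_d -> 'rV[R]_d)
    (v w : R -> 'rV[R]_d) (a b L : R) :
  a <= b -> arc F v a b -> arc F w a b -> 0 <= L ->
  (forall t, a < t < b -> `|F (w t) - F (v t)| <= L * `|w t - v t|) ->
  sqnorm (w b - v b) <= sqnorm (w a - v a) * expR (2 * L * d%:R * (b - a)).
Proof.
move=> ab [cv dv] [cw dw] L0 FL.
pose k := 2 * L * d%:R.
pose D i t := (w t - v t) ord0 i.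
pose D' i t := (F (w t) - F (v t)) ord0 i.
pose E t := sqnorm (w t - v t).
pose h t := E t * expR (- k * (t - a)).
have dD t i : a < t < b -> is_derive t (1 : R) (D i) (D' i t).
  move=> tab; apply: is_derive_coord.
  by have := dv t tab; have := dw t tab => ? ?; exact: is_deriveB.
have dE t : a < t < b -> is_derive t (1 : R) E (\sum_(i < d) 2 * (D i t * D' i t)).
  move=> tab.
  have -> : E = \sum_(i < d) (D i ^+ 2).
    by apply/funext => s; rewrite /E /sqnorm fct_sumE.
  apply: is_derive_sum => i; have := dD t i tab => ?.
  apply: is_derive_eq; rewrite expr1 /GRing.scale /=; ring.
have E'le t : a < t < b -> \sum_(i < d) 2 * (D i t * D' i t) <= k * E t.
  move=> tab; rewrite /k.
  apply: le_trans (_ : 2 * L * d%:R * `|w t - v t| ^+ 2 <= _); last first.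
    by rewrite ler_wpM2l ?sqr_norm_le_sqnorm// !mulr_ge0.
  apply: le_trans (_ : \sum_(i < d) 2 * L * `|w t - v t| ^+ 2 <= _); last first.
    rewrite sumr_const card_ord -mulr_natr le_eqVlt; apply/orP; left.
    by apply/eqP; ring.
  apply: ler_sum => i _.
  rewrite -mulrA ler_wpM2l//.
  apply: le_trans (ler_norm _) _; rewrite normrM.
  apply: le_trans (_ : `|w t - v t| * (L * `|w t - v t|) <= _); last first.
    by rewrite le_eqVlt; apply/orP; left; apply/eqP; ring.
  apply: ler_pM => //; first exact: rV_coord_le_norm.
  by apply: le_trans (FL t tab); exact: rV_coord_le_norm.
pose h' t := (\sum_(i < d) 2 * (D i t * D' i t) - k * E t) * expR (- k * (t - a)).
have dh t : a < t < b -> is_derive t (1 : R) h (h' t).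
  move=> tab; have := dE t tab => ?.
  have -> : h = E * (expR \o (fun s => - k * (s - a))).
    by apply/funext.
  have ? : is_derive t (1 : R) (fun s => - k * (s - a)) (- k).
    have -> : (fun s => - k * (s - a)) = (- k) *: (id - cst a).
      by apply/funext.
    by apply: is_derive_eq; rewrite /GRing.scale /= subr0 mulr1.
  by apply: is_derive_eq; rewrite /h' /GRing.scale /=; ring.
have ch : {within `[a, b], continuous h}.
  have -> : h = E \* (fun s => expR (- k * (s - a))) by [].
  move=> t; apply: continuousM.
    suff cE : {within `[a, b], continuous E} by exact: cE.
    have -> : E = \sum_(i < d) (D i \* D i).
      by apply/funext => s; rewrite /E /sqnorm fct_sumE; apply: eq_bigr.
    elim/big_ind: _ => [|f g cf cg|i _] s.
    - exact: cst_continuous.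
    - exact: (continuousD (cf s) (cg s)).
    have cD : {within `[a, b], continuous (D i)}.
      apply: within_continuous_coord => r.
      by apply: continuousB; [exact: cw | exact: cv].
    exact: (continuousM (cD s) (cD s)).
  apply: continuous_subspaceT => s.
  apply: continuous_comp; last exact: continuous_expR.
  apply: continuousM; first exact: cst_continuous.
  by apply: continuousB => //; exact: cst_continuous.
have : h b <= h a.
  apply: (ler0_derive1_le_cc _ _ ch); rewrite ?in_itv/= ?lexx ?ab//.
    by move=> x; rewrite in_itv/= => /dh[].
  move=> x; rewrite in_itv/= => xab; rewrite derive1E.
  have := dh x xab => ?; rewrite derive_val /h'.
  by rewrite mulr_le0_ge0 ?expR_ge0// subr_le0 E'le.
rewrite /h subrr mulr0 expR0 mulr1 mulNr expRN.
by rewrite ler_pdivrMr ?expR_gt0.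
Qed.

(** Compactness of the arc [v] gives a Lipschitz constant of [F] on a tube around
    it. Gronwall's inequality controls [w] while [w] stays in the tube, and a
    first-exit argument shows that it does stay there when [w a] is close enough
    to [v a]. For [w a = v a] this is uniqueness of solutions. *)
Lemma arc_stability (R : realType) (d : nat) (F : 'rV[R]_d -> 'rV[R]_d)
    (v : R -> 'rV[R]_d) (a b : R) :
  locally_lipschitz F -> a <= b -> arc F v a b ->
  exists2 C : R, 0 < C & forall w, arc F w a b -> `|w a - v a| < C^-1 ->
    `|w b - v b| <= C * `|w a - v a|.
Proof.
move=> lipF ab av.
have [|N N0 FN] := @lipschitz_near_compact R d F (v @` `[a, b]) lipF.
  by apply: continuous_compact; [exact: av.1 | exact: segment_compact].
(* the summand 1 makes [C0 <= C0 ^+ 2], which spares a square root *)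
pose C0 := 1 + d%:R * expR (2 * N * d%:R * (b - a)).
have C01 : 1 <= C0 by rewrite lerDl mulr_ge0// expR_ge0.
have gr w t : arc F w a b -> a <= t <= b ->
    (forall s, a <= s < t -> `|w s - v s| < N^-1) ->
    `|w t - v t| <= C0 * `|w a - v a|.
  move=> aw /andP[at_ tb] near_.
  have C00 : 0 <= C0 by lra.
  rewrite -(@ler_pXn2r _ 2)// ?nnegrE ?mulr_ge0//.
  apply: le_trans (sqr_norm_le_sqnorm _) _.
  apply: le_trans (sqnorm_gronwall at_ (arc_sub (lexx a) tb av)
    (arc_sub (lexx a) tb aw) (ltW N0) _) _.
    move=> s /andP[as_ st]; apply: FN; last by apply: near_; rewrite (ltW as_).
    by exists s => //=; rewrite in_itv/= (ltW as_) (le_trans (ltW st)).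
  apply: le_trans (_ : (d%:R * `|w a - v a| ^+ 2) * expR (2 * N * d%:R * (b - a)) <= _).
    apply: ler_pM; rewrite ?expR_ge0//.
    - by apply: sumr_ge0 => i _; rewrite sqr_ge0.
    - exact: sqnorm_le_sqr_norm.
    - by rewrite ler_expR ler_wpM2l ?lerB// !mulr_ge0 ?(ltW N0).
  rewrite exprMn mulrAC ler_wpM2r ?sqr_ge0//.
  apply: le_trans (_ : C0 <= _); first by rewrite lerDr.
  by rewrite expr2 ler_peMl.
have C0p : 0 < C0 by lra.
(* the factor [1 + N] makes the admissible initial distance so small that [C0]
   times this distance is less than the width [N^-1] of the tube *)
exists (C0 * (1 + N)); first by rewrite mulr_gt0// addr_gt0.
move=> w aw wv.
have wvN : C0 * `|w a - v a| < N^-1.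
  rewrite -ltr_pdivlMl//; apply: lt_le_trans wv _.
  rewrite invfM ler_wpM2l ?invr_ge0 ?(ltW C0p)//.
  by rewrite lef_pV2 ?posrE//; lra.
have stay : forall t, a <= t <= b -> `|w t - v t| < N^-1.
  apply: before_exit => [t|t tab near_].
    apply: continuous_comp; last exact: norm_continuous.
    by apply: continuousB; [exact: aw.1 | exact: av.1].
  exact: le_lt_trans (gr _ _ aw tab near_) wvN.
apply: le_trans (gr _ b aw _ _) _; first by rewrite ab lexx.
  by move=> s /andP[as_ sb]; apply: stay; rewrite as_ ltW.
by rewrite ler_wpM2r// ler_peMr ?(ltW C0p)//; lra.
Qed.

(** * The semiflow and solutions on an interval *)

Lemma is_derive_shift_time (R : realType) (d : nat) (u : R -> 'rV[R]_d)
    (s t : R) (v : 'rV[R]_d) :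
  is_derive (t + s) (1 : R) u v -> is_derive t (1 : R) (fun r => u (r + s)) v.
Proof.
have E : (fun h : R => h^-1 *: (u (h *: 1 + t + s) - u (t + s))) =
         (fun h : R => h^-1 *: (u (h *: 1 + (t + s)) - u (t + s))).
  by apply/funext => h; rewrite addrA.
move=> [du Du]; split; first by rewrite /derivable /= E; exact: du.
by rewrite -Du /derive /= E.
Qed.

Lemma solution_arc (R : realType) (d : nat) (F : 'rV[R]_d -> 'rV[R]_d)
    (U : set R) (u : R -> 'rV[R]_d) (a b s : R) :
  is_interval U -> solution_on F U u -> U (a + s) -> U (b + s) ->
  arc F (fun t => u (t + s)) a b.
Proof.
move=> iU du Ua Ub.
have D t : a <= t <= b -> is_derive t (1 : R) (fun r => u (r + s)) (F (u (t + s))).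
  move=> /andP[at_ tb]; apply: is_derive_shift_time; apply: du.
  by apply: iU Ua Ub _ _; rewrite !lerD2r at_.
split; last by move=> t /= /andP[at_ tb]; apply: D; rewrite !ltW.
by apply: derivable_within_continuous => t; rewrite in_itv /= => /D[].
Qed.

Lemma flow_arc (R : realType) (d : nat) (F : 'rV[R]_d -> 'rV[R]_d)
    (phi : R -> 'rV[R]_d -> 'rV[R]_d) (x : 'rV[R]_d) (m : R) :
  is_flow F phi -> 0 <= m -> arc F (phi ^~ x) 0 m.
Proof.
move=> /(_ x)[_ D0 D] m0.
(* a longer arc, to have distinct end points when [m = 0] *)
apply: (@arc_sub _ _ _ _ 0 (m + 1)) => //; first lra.
split; last by move=> t /= /andP[t0 _]; exact: D.
have c t : 0 < t -> {for t, continuous (phi ^~ x)}.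
  by move=> /D[dt _]; apply/differentiable_continuous/derivable1_diffP.
apply/continuous_within_itvP; first lra.
split.
- by move=> t; rewrite in_itv /= => /andP[t0 _]; exact: c.
(* at 0, continuity is recovered from the convergent difference quotient *)
- have : phi 0 x + h *: (h^-1 *: (phi h x - phi 0 x)) @[h --> (0 : R)^'+] -->
      phi 0 x + (0 : R) *: F (phi 0 x).
    apply: cvgD; first exact: cvg_cst.
    apply: cvgZ D0; apply: cvg_at_right_filter; exact: cvg_id.
  rewrite scale0r addr0; apply: cvg_trans; apply: near_eq_cvg.
  near=> h; rewrite scalerA mulfV ?scale1r ?subrKC//.
- by apply: cvg_at_left_filter; apply: c; lra.
Unshelve. all: by end_near. Qed.

(** From time [s] on, [u] and the semiflow orbit of [u s] are two arcs with the
    same starting point, so [arc_stability] applies with initial distance 0. *)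
Lemma flow_unique (R : realType) (d : nat) (F : 'rV[R]_d -> 'rV[R]_d)
    (phi : R -> 'rV[R]_d -> 'rV[R]_d) (U : set R) (u : R -> 'rV[R]_d) (s t : R) :
  locally_lipschitz F -> is_flow F phi -> is_interval U -> solution_on F U u ->
  U s -> U t -> s <= t -> phi (t - s) (u s) = u t.
Proof.
move=> lipF flow iU du Us Ut st.
have ts0 : 0 <= t - s by rewrite subr_ge0.
have au : arc F (fun r => u (r + s)) 0 (t - s).
  by apply: (solution_arc iU du); rewrite ?add0r ?subrK.
have [C C0] := arc_stability lipF ts0 au.
move=> /(_ _ (flow_arc (u s) flow ts0)).
have [-> _ _] := flow (u s).
rewrite add0r subrr normr0 mulr0 invr_gt0 C0 => /(_ isT).
by rewrite subrK normr_le0 subr_eq0 => /eqP.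
Qed.

(** * Dense trajectories *)

(** Two continuous fields solved by the same forward orbit agree on that orbit,
    hence on its closure. The starting point itself is only a limit of points
    where the equation holds. *)
Lemma forward_dense_determines (R : realType) (d : nat)
    (F G : 'rV[R]_d -> 'rV[R]_d) (phi : R -> 'rV[R]_d -> 'rV[R]_d)
    (x : 'rV[R]_d) :
  continuous F -> continuous G -> is_flow F phi ->
  closure (traj phi x) = setT ->
  solution_on G [set t | 0 < t] (phi ^~ x) -> G = F.
Proof.
move=> cF cG flow dense solG; have [_ _ solF] := flow x.
pose A := (fun y => G y - F y) @^-1` [set 0].
have clA : closed A.
  apply: preimage_closed => [y _|]; last first.
    exact: (accessible_closed_set1 (hausdorff_accessible (@norm_hausdorff _ _))).
  have cGy : {for y, continuous G} by exact: cG.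
  have cFy : {for y, continuous F} by exact: cF.
  exact: (continuousB cGy cFy).
have Apos t : 0 < t -> A (phi t x).
  move=> t0; have [_ GE] := solG t t0; have [_ FE] := solF t t0.
  by rewrite /A /= -GE -FE subrr.
have A0 : A (phi 0 x).
  have [cphi _] := flow_arc x flow ler01.
  have [_ phi0 _] := (continuous_within_itvP (phi ^~ x) ltr01).1 cphi.
  apply: (closed_cvg A clA _ (phi 0 x) phi0).
  by near=> t; apply: Apos; near: t; exact: nbhs_right_gt.
apply/funext => y; apply/eqP; rewrite -subr_eq0; apply/eqP.
suff : A y by [].
have : closure (traj phi x) y by rewrite dense.
rewrite ((closure_id A).1 clA); apply: closureS => _ [t /= t0 <-].
by move: t0; rewrite le_eqVlt => /predU1P[<-|/Apos].
Unshelve. all: by end_near. Qed.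

(** If the curve missed a ball, adding to [F] a bump supported in that ball would
    give another continuous field with the same solution. *)
Lemma discoverable_dense (R : realType) (d : nat) (F : 'rV[R]_d -> 'rV[R]_d)
    (U : set R) (u : R -> 'rV[R]_d) :
  (0 < d)%N -> [set G | C0 G /\ solution_on G U u] = [set F] ->
  forall p r, 0 < r -> exists2 t, U t & `|u t - p| < r.
Proof.
move=> d0 uniqF p r r0; apply: contrapT => miss.
have [cF dF] : C0 F /\ solution_on F U u.
  by have : [set F] F by []; rewrite -uniqF.
pose bump (y : 'rV[R]_d) : R := Num.max 0 (r - `|y - p|).
pose G y := F y + bump y *: const_mx 1.
have : [set F] G.
  rewrite -uniqF; split.
    move=> y.
    have ccst (V : topologicalType) (k : V) : {for y, continuous (fun=> k)}.
      exact: cst_continuous.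
    have ident : {for y, continuous (fun z : 'rV[R]_d => z)} by exact: cvg_id.
    have cdist := continuous_comp (continuousB ident (ccst 'rV[R]_d p))
      (@norm_continuous _ _ _).
    have cbump : {for y, continuous bump}.
      exact: (continuous_max (ccst R 0) (continuousB (ccst R r) cdist)).
    have cFy : {for y, continuous F} by exact: cF.
    exact: (continuousD cFy (continuousZ cbump (ccst 'rV[R]_d (const_mx 1)))).
  move=> t Ut; rewrite /G /bump max_l ?scale0r ?addr0; first exact: dF.
  rewrite subr_le0 leNgt; apply/negP => utr; apply: miss; by exists t.
move=> /= GF; have := congr1 (fun H => (H p - F p) ord0 (Ordinal d0)) GF.
rewrite /G /bump subrr normr0 subr0 max_r ?ltW// addrC addKr !mxE mulr1 => rE.
by move: r0; rewrite rE subrr ltxx.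
Qed.

(** * Late returns of a dense solution *)

(** Points of the line that are [c] apart fall into different cells of a
    subdivision of step [c]. *)
Lemma separated_points_card (R : realType) (I : finType) (s : I -> R) (a b c : R) :
  0 < c -> a <= b -> (forall i, a <= s i <= b) ->
  (forall i j, i != j -> c <= `|s i - s j|) ->
  #|I|%:R <= (b - a) / c + 1.
Proof.
move=> c0 ab sab sep.
pose k i := Num.truncn ((s i - a) / c).
pose K := (Num.truncn ((b - a) / c)).+1.
have kK i : (k i < K)%N.
  rewrite ltnS le_truncn// ler_pM2r ?invr_gt0// lerD2r.
  by case/andP: (sab i).
have ge0 i : 0 <= (s i - a) / c.
  by rewrite divr_ge0 ?(ltW c0)// subr_ge0; case/andP: (sab i).
have kinj : injective (fun i => Ordinal (kK i)).
  move=> i j [kij]; apply/eqP; apply: contraT => /sep.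
  have := truncn_itv (ge0 i); have := truncn_itv (ge0 j).
  rewrite -/(k i) -/(k j) kij -natr1 => /andP[j1 j2] /andP[i1 i2].
  rewrite leNgt => /negP[].
  have -> : s i - s j = ((s i - a) / c - (s j - a) / c) * c.
    by rewrite -mulrBl divfK ?gt_eqF//; ring.
  rewrite normrM (gtr0_norm c0) -[ltRHS]mul1r ltr_pM2r// ltr_norml.
  by apply/andP; split; lra.
have := leq_card _ kinj; rewrite card_ord -(ler_nat R) => /le_trans; apply.
rewrite -natr1 lerD2r truncn_le divr_ge0 ?subr_ge0// ltW//.
Qed.

(** A curve of bounded speed cannot come arbitrarily close to every point of a ball of
    dimension at least 2 in a bounded time. In the plane of the first two
    coordinates, a grid of [n ^ 2] points with mesh of order [1 / n] lies in the
    ball; the curve visits points near each of them, at times that are at least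
    of order [1 / n] apart because the speed is bounded by [M] near the ball.
    These times therefore spread over a length of order [n], which exceeds
    [2 * m] for large [n]. On a line the same count gives only a spread of order
    [1], and the conclusion fails for a monotone curve. *)
Lemma dense_solution_returns_late (R : realType) (d : nat)
    (F : 'rV[R]_d -> 'rV[R]_d) (U : set R) (u : R -> 'rV[R]_d)
    (p : 'rV[R]_d) (r m : R) :
  (1 < d)%N -> continuous F -> is_interval U -> solution_on F U u ->
  (forall q e, 0 < e -> exists2 t, U t & `|u t - q| < e) -> 0 < r ->
  exists s s', [/\ U s, U s', `|u s - p| < r, `|u s' - p| < r & s + m < s'].
Proof.
move=> d1 cF iU du dense r0; apply: contrapT => early.
have visits s s' : U s -> U s' -> `|u s - p| < r -> `|u s' - p| < r -> s' <= s + m.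
  move=> Us Us' us us'; rewrite leNgt; apply/negP => ss'.
  by apply: early; exists s, s'.
pose M := `|F p| + 1.
have M0 : 0 < M by rewrite ltr_wpDl.
have [e e0 FM] : exists2 e, 0 < e & forall y, `|y - p| < e -> `|F y| <= M.
  have /nbhs_ballP[e /= e0 pe] := cF p _ (nbhsx_ballx (F p) 1 ltr01).
  exists e => // y yp.
  have : ball (F p) 1 (F y) by apply: pe; rewrite -ball_normE /ball_ /= distrC.
  rewrite -ball_normE /= distrC => Fyp.
  rewrite -(subrK (F p) (F y)); apply: le_trans (ler_normD _ _) _.
  by rewrite /M addrC lerD2l ltW.
pose rho := Num.min r (e / 2).
have rho0 : 0 < rho by rewrite lt_min r0 divr_gt0.
have rhor : rho <= r by rewrite ge_min lexx.
have rhoe : 2 * rho <= e.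
  by rewrite mulrC -ler_pdivlMr// ge_min lexx orbT.
(* The grid has mesh [3 * delta] and is visited up to an error [delta], so the
   positions at distinct visits are more than [delta] apart. The choice of [n] makes [n ^ 2] exceed the number [2 * m * M / delta + 1] of
   visits [delta / M] apart that fit in a time interval of length [2 * m]. *)
pose n := (Num.truncn (6 * m * M / rho + 1)).+1.
have nbig : 6 * m * M / rho + 1 < n%:R by exact: truncnS_gt.
have n0 : 0 < n%:R :> R by rewrite ltr0n.
pose delta := rho / (3 * n%:R).
have delta0 : 0 < delta by rewrite divr_gt0// mulr_gt0.
have delta30 : 0 < 3 * delta by rewrite mulr_gt0.
have deltaE : 3 * delta * n%:R = rho by rewrite /delta; field; rewrite gt_eqF.
have n1 : 1 <= n%:R :> R by rewrite ler1n.
have delta_rho : delta <= rho.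
  rewrite -deltaE; have : delta <= delta * n%:R by rewrite ler_peMr// ltW.
  nra.
pose i0 : 'I_d := Ordinal (ltnW d1).
pose i1 : 'I_d := Ordinal d1.
pose g (ij : 'I_n * 'I_n) : 'rV[R]_d := p + \row_k
  (if k == i0 then ij.1%:R * (3 * delta)
   else if k == i1 then ij.2%:R * (3 * delta) else 0).
have gp ij : `|g ij - p| <= rho - 3 * delta.
  have small (i : 'I_n) : `|i%:R * (3 * delta)| <= rho - 3 * delta.
    rewrite ger0_norm; last by rewrite mulr_ge0 ?ler0n// mulr_ge0// ltW.
    have : (i : nat).+1%:R <= n%:R :> R by rewrite ler_nat.
    rewrite -natr1 -subr_ge0 => /mulr_ge0 /(_ (ltW delta0)).
    by rewrite -deltaE; lra.
  have nn : 0 <= rho - 3 * delta.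
    by apply: le_trans (small ord0); rewrite normr_ge0.
  rewrite /g addrC addKr; apply: rV_norm_le => // k; rewrite !mxE.
  by case: ifP => _ //; case: ifP => _ //; rewrite normr0.
have gsep ij kl : ij != kl -> 3 * delta <= `|g ij - g kl|.
  have sepn (i k : 'I_n) : i != k ->
      3 * delta <= `|i%:R * (3 * delta) - k%:R * (3 * delta)|.
    move=> ik; rewrite -mulrBl normrM (gtr0_norm delta30).
    rewrite ler_peMl ?(ltW delta30)//.
    have : (i : nat) != k by [].
    rewrite neq_ltn => /orP[|] ik'; rewrite -(ler_nat R) -natr1 in ik'.
      by rewrite distrC; apply: le_trans (ler_norm _); lra.
    by apply: le_trans (ler_norm _); lra.
  move=> ijkl.
  have gE k : (g ij - g kl) ord0 k = (g ij - p) ord0 k - (g kl - p) ord0 k.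
    by rewrite !mxE; ring.
  have [e1|ne1] := eqVneq ij.1 kl.1.
    have ne2 : ij.2 != kl.2.
      apply: contra ijkl => /eqP e2; apply/eqP.
      by case: (ij) (kl) e1 e2 => ? ? [? ?] /= -> ->.
    apply: le_trans (rV_coord_le_norm _ i1).
    rewrite gE /g !(addrC p) !addrK !mxE.
    by rewrite (_ : (i1 == i0) = false)// eqxx; exact: sepn.
  apply: le_trans (rV_coord_le_norm _ i0).
  by rewrite gE /g !(addrC p) !addrK !mxE eqxx; exact: sepn.
have /choice[s sP] : forall ij, exists t, U t /\ `|u t - g ij| < delta.
  by move=> ij; have [t Ut ut] := dense (g ij) delta delta0; exists t.
have Us ij : U (s ij) by have [] := sP ij.
have us ij : `|u (s ij) - p| < rho.
  apply: le_lt_trans (ler_distD (g ij) _ _) _.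
  by have := gp ij; have := (sP ij).2; lra.
have usr ij : `|u (s ij) - p| < r by apply: lt_le_trans rhor.
have usep ij kl : ij != kl -> delta < `|u (s ij) - u (s kl)|.
  move=> /gsep; have := ler_distD (u (s ij)) (g ij) (g kl).
  have := ler_distD (u (s kl)) (u (s ij)) (g kl).
  have := (sP ij).2; have := (sP kl).2; rewrite (distrC (u (s ij)) (g ij)).
  lra.
have speed ij kl : s ij <= s kl -> ij != kl -> delta / M <= s kl - s ij.
  move=> ijkl neq; rewrite leNgt; apply/negP.
  rewrite ltr_pdivlMr// mulrC => close.
  have au : arc F u (s ij) (s kl).
    have := @solution_arc R d F U u (s ij) (s kl) 0 iU du.
    rewrite !addr0 => /(_ (Us ij) (Us kl)).
    by rewrite (_ : (fun t => u (t + 0)) = u)//; apply/funext => t; rewrite addr0.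
  have := slow_arc ijkl au (fun y yp => FM y (lt_le_trans yp rhoe)) M0 (us ij)
    delta_rho close.
  by rewrite distrC => /(lt_trans (usep _ _ neq)); rewrite ltxx.
have z : 'I_n * 'I_n := (ord0, ord0).
have m0 : 0 <= m.
  by have := visits (s z) (s z) (Us z) (Us z) (usr z) (usr z); rewrite lerDl.
(* without late returns, all visits happen within time [m] of the visit to [z] *)
have : #|{: 'I_n * 'I_n}|%:R <= ((s z + m) - (s z - m)) / (delta / M) + 1.
  apply: (@separated_points_card R _ s) => [||ij|ij kl neq]; first exact: divr_gt0.
  - by lra.
  - have := visits (s z) (s ij) (Us z) (Us ij) (usr z) (usr ij).
    have := visits (s ij) (s z) (Us ij) (Us z) (usr ij) (usr z).
    by move=> ? ?; apply/andP; split; lra.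
  have [le_|/ltW le_] := leP (s ij) (s kl).
    by rewrite distrC; apply: le_trans (ler_norm _); exact: speed.
  by apply: le_trans (ler_norm _); apply: speed => //; rewrite eq_sym.
rewrite card_prod card_ord natrM => count.
have : n%:R * n%:R <= 6 * m * M / rho * n%:R + 1.
  apply: le_trans count _; rewrite lerD2r le_eqVlt; apply/orP; left; apply/eqP.
  by rewrite /delta; field; rewrite !gt_eqF.
have : (6 * m * M / rho + 1) * n%:R < n%:R * n%:R by rewrite ltr_pM2r.
rewrite mulrDl; lra.
Qed.

(** * Transitivity *)

Lemma open_dist (R : realType) (d : nat) (W : set 'rV[R]_d) (p : 'rV[R]_d) :
  open W -> W p -> exists2 e : R, 0 < e & forall y, `|y - p| < e -> W y.
Proof.
rewrite openE => oW /oW /nbhs_ballP[e /= e0 eW]; exists e => // y yp.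
by apply: eW; rewrite -ball_normE /= distrC.
Qed.

(** Density gives times [s1] and [s2] with [u s1] in [W1] and [u s2] in [W2]. The
    difficulty is [s2 <= s1], as the density of [u] might come from its past.
    Put [m = s1 - s2]. Points close to [u s2] lie in [W2] and are carried into
    [W1] after time [m]. By the late returns, [u] passes close to [u s2] at two
    times [s < s'] with [s + m < s']; then [u (s + m)] is in [W1] and is followed
    by [u s'] in [W2]. *)
Lemma dense_solution_transitive (R : realType) (d : nat)
    (F : 'rV[R]_d -> 'rV[R]_d) (phi : R -> 'rV[R]_d -> 'rV[R]_d)
    (U : set R) (u : R -> 'rV[R]_d) :
  (1 < d)%N -> locally_lipschitz F -> is_flow F phi ->
  is_interval U -> solution_on F U u ->
  (forall q e, 0 < e -> exists2 t, U t & `|u t - q| < e) ->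
  topologically_transitive phi.
Proof.
move=> d1 lipF flow iU du dense W1 W2 oW1 [p1 W1p] oW2 [p2 W2p].
have visit W p : open W -> W p -> exists2 t, U t & W (u t).
  move=> oW /(open_dist oW)[e e0 eW]; have [t Ut ut] := dense p e e0.
  by exists t => //; exact: eW.
have [s1 Us1 W1s] := visit W1 p1 oW1 W1p.
have [s2 Us2 W2s] := visit W2 p2 oW2 W2p.
suff [s [s' [Us Us' ss' W1u W2u]]] : exists s s',
    [/\ U s, U s', s < s', W1 (u s) & W2 (u s')].
  exists (s' - s); first by rewrite subr_gt0.
  exists (u s'); split => //; exists (u s) => //.
  exact: (flow_unique lipF flow iU du Us Us' (ltW ss')).
have [s12|s21] := ltP s1 s2; first by exists s1, s2.
pose m := s1 - s2.
have m0 : 0 <= m by rewrite subr_ge0.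
have [e1 e10 eW1] := open_dist oW1 W1s.
have [e2 e20 eW2] := open_dist oW2 W2s.
have [|C C0 stable] := @arc_stability R d F (fun t => u (t + s2)) 0 m lipF m0.
  by apply: (solution_arc iU du); rewrite ?add0r ?subrK.
have r0 : 0 < Num.min e2 (Num.min C^-1 (e1 / C)).
  by rewrite !lt_min e20 invr_gt0 C0 divr_gt0.
have cF := locally_lipschitz_continuous lipF.
have [s [s' [Us Us' us us' ss']]] :=
  dense_solution_returns_late (u s2) m d1 cF iU du dense r0.
move: us us'; rewrite !lt_min => /and3P[_ usC use] /andP[us'e _].
have Usm : U (m + s).
  by apply: (iU _ _ Us Us'); apply/andP; split; lra.
exists (m + s), s'; split => //; [by rewrite addrC | | exact: eW2].
apply: eW1; have := stable (fun t => u (t + s)).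
rewrite !add0r subrK => /(_ _ usC) le_.
apply: le_lt_trans (le_ _) _; last by rewrite mulrC -ltr_pdivlMr.
by apply: (solution_arc iU du); rewrite ?add0r.
Qed.

Theorem theorem4p1 (R : realType) (d : nat) (hd : (1 < d)%N)
    (F : 'rV[R]_d -> 'rV[R]_d) (hF : locally_lipschitz F)
    (phi : R -> 'rV[R]_d -> 'rV[R]_d) (hphi : is_flow F phi) :
  (chaotic phi setT -> discoverable (@C0 R d) F) /\
  (discoverable (@C0 R d) F -> topologically_transitive phi).
Proof.
have cF := locally_lipschitz_continuous hF.
split=> [[_ _ [x _ dense]]|[U [u [_ iU _ uniqF]]]].
  have [_ _ sol] := hphi x.
  exists [set t | 0 < t], (phi ^~ x); split.
  - exact: open_gt.
  - by move=> s t /= s0 t0 z /andP[sz _]; apply: lt_le_trans sz.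
  - by exists 1 => /=.
  apply/seteqP; split=> [G [cG solG]|_ ->]; last by split.
  exact: (forward_dense_determines cF cG hphi dense solG).
have [_ du] : C0 F /\ solution_on F U u.
  by have : [set F] F by []; rewrite -uniqF.
apply: (dense_solution_transitive hd hF hphi iU du).
exact: (discoverable_dense (ltnW hd) uniqF).
Qed.
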